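(* Let $t>1$ be odd, $G\cong\mathbb{Z}_t\times\mathbb{Z}_2^2$, and let $\psi=\partial_{d_1}\cdots\partial_{d_k}\,\rho$ be a cocycle over $G$ with values in $\{\pm1\}$. Then the operation $C_2$ on $M_\psi$ coincides with transposition: $$C_2(M_\psi)=(M_\psi)^{\top}=M_{\psi^\top},$$ where $C_2(M_\psi)$ denotes $M_{C_2(\psi)}$ and $\psi^\top$ is the cocycle $\psi^\top(g,h)=\psi(h,g)$.
   Context: Let $t>1$ be odd and $G=\langle x,u,v: x^t=u^2=v^2=1,\ xu=ux,\ xv=vx,\ uv=vu\rangle\cong\mathbb{Z}_t\times\mathbb{Z}_2^2$. List the elements of $G$ as $g_1,\dots,g_{4t}$ with $g_{4j+1}=x^j$, $g_{4j+2}=x^ju$, $g_{4j+3}=x^jv$, $g_{4j+4}=x^juv$ for $0\le j\le t-1$. A (normalized) cocycle is a map $\psi:G\times G\to\{\pm1\}$ with $\psi(g,1)=\psi(1,g)=1$ and $\psi(g,h)\psi(gh,k)=\psi(g,hk)\psi(h,k)$ for all $g,h,k\in G$; its cocyclic matrix is $M_\psi=[\psi(g,h)]_{g,h\in G}$ with rows and columns indexed by $G$ in the order $g_1,\dots,g_{4t}$. For $f:G\to\{\pm1\}$ put $\partial f(g,h)=f(g)^{-1}f(h)^{-1}f(gh)$. Let $\delta_i:G\to\{\pm1\}$ be $-1$ at $g_i$ and $1$ elsewhere. Put $\partial_i=\partial\delta_i$ for $2\le i\le 4t$, and let $\partial_1=-\partial\delta_1=\partial(-\delta_1)$ (the normalized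 version of $\partial\delta_1$). Let $\rho$ be the cocycle $\rho(x^ia,x^jb)=\rho_0(a,b)$ for $a,b\in\{1,u,v,uv\}$, where, with rows and columns ordered $1,u,v,uv$, $$[\rho_0(a,b)]=\begin{pmatrix}1&1&1&1\\1&-1&1&-1\\1&-1&-1&1\\1&1&-1&-1\end{pmatrix}.$$ For $D\subseteq\{1,\dots,4t\}$ write $\psi_D=\big(\prod_{d\in D}\partial_d\big)\rho$. The complement operation $C_2$ acts by $C_2(\psi_D)=\psi_{D'}$, where $D'$ is obtained from $D$ by replacing $\{d\in D: d\equiv2\bmod4\}$ by its complement in $\{d\in\{1,\dots,4t\}: d\equiv 2\bmod 4\}$ and keeping all other elements of $D$. *)

(* Defs.v *)
From mathcomp Require Import all_boot all_algebra all_fingroup.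
Set Implicit Arguments.
Unset Strict Implicit.
Unset Printing Implicit Defensive.
Import GRing.Theory.
Local Open Scope ring_scope.

Definition pm1 (a : int) : Prop := a = 1 \/ a = -1.

Lemma pm1M a b : pm1 a -> pm1 b -> pm1 (a * b).
Proof. by case=> ->; case=> ->; [left|right|right|left]. Qed.

Lemma pm1V a : pm1 a -> a^-1 = a.
Proof. by case=> ->. Qed.

Lemma pm1_sqr a : pm1 a -> a * a = 1.
Proof. by case=> ->. Qed.

Section Cocycles.
Variable gT : finGroupType.

Record cocycle := Cocycle {
  cocycle_fun :> gT -> gT -> int;
  cocycle_pm1 : forall g h, pm1 (cocycle_fun g h);
  cocycle_g1 : forall g, cocycle_fun g 1%g = 1;
  cocycle_1g : forall g, cocycle_fun 1%g g = 1;
  cocycleP : forall g h k,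
    cocycle_fun g h * cocycle_fun (g * h)%g k
      = cocycle_fun g (h * k)%g * cocycle_fun h k }.

Definition cocycle1 : cocycle.
Proof. by exists (fun _ _ => 1) => //; left. Defined.

Definition cocycleM (p q : cocycle) : cocycle.
Proof.
exists (fun g h => p g h * q g h) => [g h|g|g|g h k].
- by apply: pm1M; apply: cocycle_pm1.
- by rewrite !cocycle_g1.
- by rewrite !cocycle_1g.
- by rewrite mulrACA !cocycleP mulrACA.
Defined.

(* The transpose is again a cocycle because the group is abelian. *)
Definition cocycle_tr (abelG : forall g h : gT, (g * h = h * g)%g)
  (p : cocycle) : cocycle.
Proof.
exists (fun g h => p h g) => [g h|g|g|g h k].
- exact: cocycle_pm1.
- exact: cocycle_1g.
- exact: cocycle_g1.
- by rewrite (abelG g h) (abelG h k) mulrC -cocycleP mulrC.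
Defined.

Definition cobound (f : gT -> int) (g h : gT) : int :=
  (f g)^-1 * (f h)^-1 * f (g * h)%g.

Definition coboundary (f : gT -> int) (f_pm1 : forall g, pm1 (f g))
  (f1 : f 1%g = 1) : cocycle.
Proof.
exists (cobound f) => [g h|g|g|g h k]; rewrite /cobound.
- by rewrite !pm1V //; do !apply: pm1M.
- by rewrite f1 mulg1 invr1 mulr1 pm1V // pm1_sqr.
- by rewrite f1 mul1g invr1 mul1r pm1V // pm1_sqr.
- rewrite !pm1V // mulgA.
  case: (f_pm1 g) => ->; case: (f_pm1 h) => ->; case: (f_pm1 k) => ->;
  case: (f_pm1 (g * h)%g) => ->; case: (f_pm1 (h * k)%g) => ->;
  case: (f_pm1 (g * h * k)%g) => ->; by [].
Defined.

End Cocycles.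

Definition klein : finGroupType := ('Z_2 * 'Z_2)%type.

(* This is Z_t x Z_2^2 only for t > 1, since 'Z_0 and 'Z_1 denote Z/2. *)
Definition G (t : nat) : finGroupType := ('Z_t * klein)%type.

Definition gen_x (t : nat) : G t := (1%R : 'Z_t, 1%g).
Definition klein_u : klein := (1%R : 'Z_2, 0%R : 'Z_2).
Definition klein_v : klein := (0%R : 'Z_2, 1%R : 'Z_2).
Definition klein_seq : seq klein :=
  [:: 1; klein_u; klein_v; klein_u * klein_v]%g.
Definition gen_u (t : nat) : G t := (1%g, klein_u).
Definition gen_v (t : nat) : G t := (1%g, klein_v).

Lemma G_comm (t : nat) (g h : G t) : (g * h = h * g)%g.
Proof.
by case: g => a [b c]; case: h => a' [b' c']; congr (_, (_, _)); apply: addrC.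
Qed.

(* The ordinal i : 'I_(4 * t) stands for the one-based index i.+1. *)
Definition elt (t : nat) (i : 'I_(4 * t)) : G t :=
  (gen_x t ^+ (i %/ 4)
   * nth 1 [:: 1; gen_u t; gen_v t; gen_u t * gen_v t] (i %% 4))%g.

Definition cocyclic_mx (t : nat) (psi : cocycle (G t)) : 'M[int]_(4 * t) :=
  \matrix_(i, j) psi (elt i) (elt j).

Definition delta (t : nat) (i : 'I_(4 * t)) (g : G t) : int :=
  if g == elt i then -1 else 1.

(* As elt i = 1 for the first index, delta i 1 = -1 there, and the sign makes
   the coboundary normalized. *)
Definition ndelta (t : nat) (i : 'I_(4 * t)) (g : G t) : int :=
  if i.+1 == 1%N then - delta i g else delta i g.

Lemma ndelta_pm1 (t : nat) (i : 'I_(4 * t)) g : pm1 (ndelta i g).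
Proof.
rewrite /ndelta /delta.
by case: ifP => _; case: ifP => _; rewrite ?opprK; [left|right|right|left].
Qed.

Lemma gen_xX (t k : nat) : (gen_x t ^+ k)%g = (inZp k : 'Z_t, 1%g).
Proof.
elim: k => [|k IH]; first by congr (_, _); apply: val_inj; rewrite /= mod0n.
rewrite expgS IH; congr (_, _); last by rewrite mulg1.
by apply: val_inj; rewrite /= modnDm.
Qed.

Lemma eltE (t : nat) (i : 'I_(4 * t)) :
  elt i = (inZp (i %/ 4) : 'Z_t, nth 1%g klein_seq (i %% 4)).
Proof.
rewrite /elt gen_xX.
have : (i %% 4 < 4)%N by rewrite ltn_mod.
by case: (i %% 4)%N => [|[|[|[|m]]]] // _;
  apply: (congr2 pair); rewrite /= ?mul1g ?mulg1.
Qed.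

Lemma elt_eq1 (t : nat) (i : 'I_(4 * t)) : (elt i == 1%g) = (i.+1 == 1%N).
Proof.
rewrite eltE; apply/eqP/idP => [[]|/eqP[->]]; last first.
  by congr (_, _); apply: val_inj; rewrite /= mod0n.
move=> q0 a1.
have lt_q : (i %/ 4 < t)%N by rewrite ltn_divLR // [(t * 4)%N]mulnC.
have lt_q2 : (i %/ 4 < (Zp_trunc t).+2)%N.
  by apply: leq_trans lt_q _; rewrite /Zp_trunc; case: (t) => [|[|n]].
rewrite (modn_small lt_q2) in q0.
have lt_r : (i %% 4 < 4)%N by rewrite ltn_mod.
rewrite (divn_eq i 4) q0; move: a1 lt_r.
by case: (i %% 4)%N => [|[|[|[|m]]]].
Qed.

Lemma ndelta1 (t : nat) (i : 'I_(4 * t)) : ndelta i 1%g = 1.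
Proof.
by rewrite /ndelta /delta (eq_sym _ (elt i)) elt_eq1; case: (i.+1 == 1%N).
Qed.

Definition partial (t : nat) (i : 'I_(4 * t)) : cocycle (G t) :=
  coboundary (@ndelta_pm1 t i) (ndelta1 i).

(* Rows and columns are in the order of klein_seq. *)
Definition rho0_table : seq (seq int) :=
  [:: [:: 1;  1;  1;  1];
      [:: 1; -1;  1; -1];
      [:: 1; -1; -1;  1];
      [:: 1;  1; -1; -1]].

Definition rho0 (a b : klein) : int :=
  nth 0 (nth [::] rho0_table (index a klein_seq)) (index b klein_seq).

Lemma rho0_cocycle :
  [/\ forall a b, pm1 (rho0 a b), forall a, rho0 a 1%g = 1,
      forall a, rho0 1%g a = 1
    & forall a b c,
        rho0 a b * rho0 (a * b)%g c = rho0 a (b * c)%g * rho0 b c].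
Proof.
have ind (P : klein -> Prop) : P (0 : 'Z_2, 0 : 'Z_2) -> P (1 : 'Z_2, 0 : 'Z_2)
    -> P (0 : 'Z_2, 1 : 'Z_2) -> P (1 : 'Z_2, 1 : 'Z_2) -> forall a, P a.
  move=> P00 P10 P01 P11 [a b].
  have z2 (c : 'Z_2) : c = 0 \/ c = 1.
    by case: c => [[|[|//]] lt]; [left | right]; apply: val_inj.
  by case: (z2 a) => ->; case: (z2 b) => ->.
split.
- by elim/ind; elim/ind; first [by left | by right].
- by elim/ind.
- by elim/ind.
- by elim/ind; elim/ind; elim/ind.
Qed.

(* The second component of x^i a, with a in {1, u, v, uv}, is a. *)
Definition rho (t : nat) : cocycle (G t).
Proof.
by exists (fun g h => rho0 g.2 h.2) => *; case: rho0_cocycle.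
Defined.

Definition psi (t : nat) (D : {set 'I_(4 * t)}) : cocycle (G t) :=
  cocycleM (\big[@cocycleM (G t)/@cocycle1 (G t)]_(d in D) partial d) (rho t).

(* The operation C_2 on cocycles sends psi D to psi (compl2 D). *)
Definition compl2 (t : nat) (D : {set 'I_(4 * t)}) : {set 'I_(4 * t)} :=
  [set d : 'I_(4 * t) | if d.+1 == 2 %[mod 4] then d \notin D else d \in D].

(* Main.v *)
Require Import Defs.
From mathcomp Require Import all_boot all_algebra all_fingroup.
Set Implicit Arguments.
Unset Strict Implicit.
Unset Printing Implicit Defensive.
Import GRing.Theory.
Local Open Scope ring_scope.

(** Values of the coboundaries are signs, so complementing part of D multiplies
    the product of coboundaries by the product over the whole class of indices
    congruent to 2 modulo 4 ([prod_compl2]).  That class enumerates the coset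
    <x>u once each, so the product of its [ndelta]s is the function that is -1
    exactly on <x>u ([prod_ndelta_coset_u]); it factors through the projection
    to the Klein group.  Its coboundary therefore comes from the coboundary of
    [sign_u] on {1, u, v, uv}, which is -1 at (a, b) when a, b are distinct and
    both nontrivial, and 1 elsewhere.  These are exactly the pairs where
    [rho0] is not symmetric, so multiplying [rho0] by this coboundary
    transposes it ([rho0_tr]).  The other factors of psi are coboundaries over
    an abelian group, hence symmetric. *)

Lemma cocycle_bigE (gT : finGroupType) (I : finType) (P : pred I)
    (F : I -> cocycle gT) g h :
  (\big[@cocycleM gT/@cocycle1 gT]_(d | P d) F d) g h = \prod_(d | P d) F d g h.
Proof. exact: (big_morph (fun p : cocycle gT => p g h)). Qed.

Lemma partial_sym (t : nat) (d : 'I_(4 * t)) g h : partial d g h = partial d h g.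
Proof. by rewrite /= /cobound (mulrC (_ g)^-1) (G_comm g h). Qed.

(** A sign squares to 1, so an index of the class that lies in D cancels with
    its second occurrence in the product over the class. *)
Lemma prod_compl2 (t : nat) (D : {set 'I_(4 * t)}) (F : 'I_(4 * t) -> int) :
    (forall d, pm1 (F d)) ->
  \prod_(d in compl2 D) F d
    = \prod_(d in D) F d * \prod_(d : 'I_(4 * t) | d.+1 == 2 %[mod 4]) F d.
Proof.
move=> F_pm1; rewrite big_mkcond [\prod_(d in D) _]big_mkcond.
rewrite [\prod_(d | _ == _ %[mod 4]) _]big_mkcond -big_split /=.
apply: eq_bigr => d _; rewrite inE.
by case: (_ == _ %[mod 4]); case: (d \in D); rewrite /= ?mulr1 ?mul1r // pm1_sqr.
Qed.

Definition sign_u (a : klein) : int := if a == klein_u then -1 else 1.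

Lemma modn4_class2 (d : nat) : (d.+1 == 2 %[mod 4]) = (d %% 4 == 1)%N.
Proof. exact: (eqn_modDl 1 d 1 4). Qed.

Lemma elt_class2 (t : nat) (d : 'I_(4 * t)) :
  d.+1 == 2 %[mod 4] -> elt d = (inZp (d %/ 4) : 'Z_t, klein_u).
Proof. by rewrite modn4_class2 eltE => /eqP->. Qed.

(** For t > 1 the class of 2 modulo 4 enumerates the coset <x>u bijectively:
    the element (a, u) has the zero-based index 4 a + 1. *)
Lemma prod_ndelta_coset_u (t : nat) (t_gt1 : (1 < t)%N) (g : G t) :
  \prod_(d : 'I_(4 * t) | d.+1 == 2 %[mod 4]) ndelta d g = sign_u g.2.
Proof.
have ndeltaE (d : 'I_(4 * t)) : d.+1 == 2 %[mod 4] ->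
    ndelta d g = if g == (inZp (d %/ 4) : 'Z_t, klein_u) then -1 else 1.
  move=> d2; rewrite /ndelta /delta (elt_class2 d2).
  (* The class avoids the first index, the only one with a sign adjustment. *)
  by case: eqP => // -[d0]; rewrite d0 in d2.
rewrite (eq_bigr _ ndeltaE) /sign_u; case: g {ndeltaE} => a b /=.
case: eqP => [-> | b_nu]; last first.
  by apply: big1 => d _; case: eqP => // -[_ /b_nu].
have a_lt : (a < t)%N by rewrite -{2}(Zp_cast t_gt1).
have d0_lt : (4 * a + 1 < 4 * t)%N.
  by apply: (@leq_trans (4 * a.+1)); rewrite ?leq_pmul2l // mulnS addnC ltn_add2r.
rewrite (bigD1 (Ordinal d0_lt)) /=; last first.
  by rewrite modn4_class2 mulnC modnMDl.
have -> : inZp ((4 * a + 1) %/ 4) = a.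
  by rewrite [(4 * a)%N]mulnC divnMDl // addn0 valZpK.
rewrite eqxx big1 ?mulr1 // => d.
rewrite modn4_class2 => /andP[/eqP d1 /eqP d_ne]; case: eqP => // -[a_d].
have dq_lt : (d %/ 4 < t)%N by rewrite ltn_divLR // [(t * 4)%N]mulnC.
case: d_ne; apply: val_inj; rewrite /= {1}(divn_eq d 4) d1 a_d /=.
by rewrite Zp_cast // modn_small // [(_ %/ _ * _)%N]mulnC.
Qed.

(** The coboundary of [sign_u] is -1 exactly at the pairs of distinct
    nontrivial elements, which are the pairs where [rho0] is asymmetric. *)
Lemma rho0_tr (a b : klein) :
  cobound sign_u a b * rho0 a b = rho0 b a.
Proof.
have z2 (c : 'Z_2) : c = 0 \/ c = 1.
  by case: c => [[|[|//]] lt]; [left | right]; apply: val_inj.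
case: a b => a1 a2 [b1 b2].
by case: (z2 a1) => ->; case: (z2 a2) => ->;
   case: (z2 b1) => ->; case: (z2 b2) => ->.
Qed.

Lemma prod_partial_coset_u (t : nat) (t_gt1 : (1 < t)%N) (g h : G t) :
  \prod_(d : 'I_(4 * t) | d.+1 == 2 %[mod 4]) partial d g h
    = cobound sign_u g.2 h.2.
Proof.
have ndeltaV (d : 'I_(4 * t)) k : (ndelta d k)^-1 = ndelta d k.
  exact/pm1V/ndelta_pm1.
have signV a : (sign_u a)^-1 = sign_u a by rewrite /sign_u; case: ifP.
rewrite /cobound !signV -[(g.2 * h.2)%g]/((g * h)%g.2).
rewrite -!prod_ndelta_coset_u // -!big_split /=.
by apply: eq_bigr => d _; rewrite /cobound !ndeltaV.
Qed.

Lemma psi_compl2 (t : nat) (t_gt1 : (1 < t)%N) (D : {set 'I_(4 * t)}) g h :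
  psi (compl2 D) g h = psi D h g.
Proof.
rewrite /= !cocycle_bigE prod_compl2; last by move=> d; apply: cocycle_pm1.
rewrite prod_partial_coset_u // -mulrA rho0_tr.
by congr (_ * _); apply: eq_bigr => d _; apply: partial_sym.
Qed.

Theorem theorem5 (t : nat) (t_gt1 : (1 < t)%N) (t_odd : odd t)
    (D : {set 'I_(4 * t)}) :
  cocyclic_mx (psi (compl2 D)) = (cocyclic_mx (psi D))^T
  /\ (cocyclic_mx (psi D))^T = cocyclic_mx (cocycle_tr (@G_comm t) (psi D)).
Proof.
split; apply/matrixP => i j; last by rewrite !mxE.
by rewrite !mxE psi_compl2.
Qed.
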